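(* A uniform permutation matrix $V_N$ has a limiting traffic distribution and satisfies the factorization property. For any $*$-test graph $T$ in one variable, $$\tau_N^0[T(V_N)]\longrightarrow_{N\to\infty}\begin{cases}1&\text{if }T\text{ is a directed line},\\0&\text{otherwise.}\end{cases}$$
   Context: A uniform permutation matrix is uniformly distributed among the $N!$ permutation matrices of size $N$. A $*$-test graph in one variable $x$ is $T=(V,E,\varepsilon)$, where $(V,E)$ is a finite connected directed graph (loops and multiple edges allowed, $V\ne\emptyset$, $E$ possibly empty) and $\varepsilon:E\to\{1,*\}$, edge $e$ having label $x^{\varepsilon(e)}$. For a random matrix $A_N$, $$\tau_N^0[T(A_N)]=\mathbb E\Big[\frac1N\sum_{\phi:V\to\{1,\dots,N\}\text{ injective}}\ \prod_{e=(v,w)\in E}A_N^{\varepsilon(e)}(\phi(w),\phi(v))\Big],$$ where $e=(v,w)$ goes from $v$ to $w$; $\mathrm{Tr}[T(A_N)]$ denotes the sum over all (not necessarily injective) maps $\phi$, without expectation and without the factor $1/N$, and $\tau_N[T(A_N)]=\mathbb E[\frac1N\mathrm{Tr}\,T(A_N)]$. $A_N$ converges in traffic distribution if $\tau[T]:=\lim_N\tau_N[T(A_N)]$ exists for every $*$-test graph $T$ (equivalently $\lim_N\tau_N^0[T(A_N)]$ exists for every $T$). It satisfies the factorization property if moreover $\mathbb E[\prod_{k=1}^K\frac1N\mathrm{Tr}\,T_k(A_N)]\to\prod_{k=1}^K\tau[T_k]$ for all $K\ge2$ and all $*$-test graphs $T_1,\dots,T_K$. A $*$-test graph $T$ is a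 directed line if there is an integer $K\ge1$ such that the vertices of $T$ are $1,\dots,K$ and its directed edges are $(1,2),\dots,(K-1,K)$ labeled $x$ and $(2,1),\dots,(K,K-1)$ labeled $x^*$, with arbitrary multiplicities (possibly zero, $T$ being connected). *)

(* Defs.v *)
From HB Require Import structures.
From mathcomp Require Import all_boot all_order all_algebra perm.
From mathcomp Require Import complex.
From mathcomp Require Import all_classical all_reals all_analysis.

Set Implicit Arguments.
Unset Strict Implicit.
Unset Printing Implicit Defensive.

Import Order.TTheory GRing.Theory Num.Theory.
Import numFieldNormedType.Exports.

Local Open Scope classical_set_scope.
Local Open Scope complex_scope.
Local Open Scope ring_scope.

(* An edge e goes from [src e] to [tgt e]; its label is x^* when [star e] is
   true and x otherwise. Connectedness ignores the orientation of the edges. *)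
Record test_graph := TestGraph {
  vertex : finType;
  edge : finType;
  src : edge -> vertex;
  tgt : edge -> vertex;
  star : edge -> bool;
  vertex_gt0 : (0 < #|vertex|)%N;
  test_graph_connected : forall v w : vertex,
    connect [rel a b | [exists e, ((src e == a) && (tgt e == b))
                               || ((src e == b) && (tgt e == a))]] v w }.

(* The vertices of a line with K vertices are numbered 0, ..., K - 1. Edges
   labeled x increase the number by one, edges labeled x^* decrease it by one;
   that consecutive vertices are joined follows from connectedness. *)
Definition directed_line (T : test_graph) : Prop :=
  exists (K : nat) (f : vertex T -> 'I_K),
    [/\ (1 <= K)%N, bijective f &
        forall e : edge T,
          if star e then nat_of_ord (f (src e)) = (f (tgt e)).+1
          else nat_of_ord (f (tgt e)) = (f (src e)).+1].

Section Traces.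
Variables (R : realType) (N : nat).
Implicit Types (T : test_graph) (A : 'M[R[i]]_N).

Definition graph_weight T A (phi : vertex T -> 'I_N) : R[i] :=
  \prod_(e : edge T)
    (if star e then map_mx Num.conj A^T else A) (phi (tgt e)) (phi (src e)).

Definition Tr T A : R[i] :=
  \sum_(phi : {ffun vertex T -> 'I_N}) graph_weight A phi.

Definition Tr0 T A : R[i] :=
  \sum_(phi : {ffun vertex T -> 'I_N} | injectiveb phi) graph_weight A phi.

End Traces.

(* The regular module R[i]^o is used because it carries the norm topology of the
   complex numbers, whereas R[i] itself has no topology.
   Meaningful when the real and imaginary parts of X are integrable, since
   [fine] maps infinite values to 0. *)
Definition cexpectation d (Om : measurableType d) (R : realType)
    (P : probability Om R) (X : Om -> R[i]) : R[i]^o :=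
  fine ('E_P[fun w => complex.Re (X w)])%E
  +i* fine ('E_P[fun w => complex.Im (X w)])%E.

Section RandomMatrix.
Variables (R : realType) (d : measure_display) (Om : measurableType d).
Variables (P : probability Om R) (N : nat).
Implicit Types (A : Om -> 'M[R[i]]_N) (T : test_graph).

Definition random_matrix A : Prop :=
  forall i j : 'I_N,
    measurable_fun [set: Om] (fun w => complex.Re (A w i j)) /\
    measurable_fun [set: Om] (fun w => complex.Im (A w i j)).

Definition uniform_permutation_matrix A : Prop :=
  random_matrix A /\
  forall s : 'S_N, P [set w | A w = perm_mx s] = ((N`!%:R)^-1)%:E.

Definition tau_mx T A : R[i]^o :=
  cexpectation P (fun w => N%:R^-1 * Tr T (A w)).

Definition tau0_mx T A : R[i]^o :=
  cexpectation P (fun w => N%:R^-1 * Tr0 T (A w)).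

End RandomMatrix.

Section TrafficConvergence.
Variables (R : realType) (d : nat -> measure_display).
Variables (Om : forall N, measurableType (d N)).
Variables (P : forall N, probability (Om N) R).
Variables (A : forall N, Om N -> 'M[R[i]]_N).

Definition converges_in_traffic_distribution : Prop :=
  forall T : test_graph, cvg (tau_mx (P N) T (@A N) @[N --> \oo]).

Definition traffic_limit (T : test_graph) : R[i]^o :=
  lim (tau_mx (P N) T (@A N) @[N --> \oo]).

Definition factorization_property : Prop :=
  converges_in_traffic_distribution /\
  forall (K : nat) (Ts : 'I_K -> test_graph), (2 <= K)%N ->
    cexpectation (P N) (fun w => \prod_(k < K) (N%:R^-1 * Tr (Ts k) (@A N w)))
      @[N --> \oo] --> \prod_(k < K) traffic_limit (Ts k).

End TrafficConvergence.

(* Main.v *)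
Require Import Defs.
From mathcomp Require Import all_boot all_order all_algebra perm.
From mathcomp Require Import complex.
From mathcomp Require Import all_classical all_reals all_analysis.
From mathcomp Require Import zify measurable_realfun.
Import Order.TTheory GRing.Theory Num.Theory.
Import numFieldNormedType.Exports.

(** Let g be the inverse of the random permutation s. Since the entry (i, j) of
    the permutation matrix of s is 1 exactly when s i = j, the weight of a map
    phi : V -> {1, ..., N} is 1 if phi follows g along every edge (forward along
    an x-edge, backward along an x^*-edge) and 0 otherwise. Such a map is called
    a labeling, and Tr and Tr0 count the labelings and the injective labelings.

    As T is connected and g is injective, a labeling is determined by its value
    at one vertex r: phi(v) is g^(h v - M) applied to phi(r), where the exponent is
    obtained by walking from r to v (exists_potential, labeling_determined). So
    T has at most N labelings, and two cases arise.

    - T has a height: a function k on the vertices that increases by one along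
      each x-edge and decreases by one along each x^*-edge. Then every point i
      gives the labeling v |-> g^(k v) i, and there are exactly N labelings.
    - T has no height. Walking around some closed walk then yields a fixed c > 0,
      depending on T only, such that the value at r of each labeling is a fixed
      point of g^c (card_labelings_nonheight).

    A uniform permutation has few points of small period: if c > 0, the expected
    number of fixed points of s^c is bounded as N grows (sum_card_periodic_points).
    The reason is that the probability that the orbit of i closes up after exactly
    l steps is at most 1 / (N - l).

    So (1/N) Tr T always lies in [0, 1]; for N >= 1 it is equal to 1 if T has a
    height, and it tends to 0 in mean otherwise. Convergence in traffic
    distribution and the factorization property both follow: if all factors are
    1, so is the product; otherwise the product is dominated by one factor that
    vanishes in mean.

    For the injective trace, T is a directed line exactly when it has an injective
    height (directed_lineP). If so, v |-> g^(k v) i fails to be injective only when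
    i is fixed by g^(k v - k w) for some v <> w, which concerns a vanishing
    proportion of the points i, and the limit is 1. If T has a height that is not
    injective there is no injective labeling at all; if T has no height, Tr0 is
    at most Tr. In both cases the limit is 0. *)

Set Implicit Arguments.
Unset Strict Implicit.
Unset Printing Implicit Defensive.

(** * Points of small period of a uniform permutation *)
Section PeriodicPoints.
Local Open Scope nat_scope.

Lemma iter_injective (X : Type) (g : X -> X) n :
  injective g -> injective (iter n g).
Proof. by move=> gI; elim: n => [|n IHn] x y //= /gI /IHn. Qed.

(** With truncated subtraction, a - b + (b - a) is the distance between a and b.
    All powers of g are kept nonnegative in this way, so that g can be any
    injective map. *)
Lemma iter_dist (X : Type) (g : X -> X) a b (x : X) : injective g ->
  iter a g x = iter b g x -> iter (a - b + (b - a)) g x = x.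
Proof.
move=> gI; wlog le_ba : a b / b <= a => [W|] eq_ab.
  have [le_ba|/ltnW le_ab] := leqP b a; first exact: W.
  by rewrite addnC; apply: W.
have -> : a - b + (b - a) = a - b by lia.
by apply: (iter_injective (n := b) gI); rewrite -iterD subnKC.
Qed.

Definition periodic_points N (s : 'S_N) (c : nat) : pred 'I_N :=
  [pred i | iter c s i == i].

Lemma iter_neq_order (T : finType) (f : T -> T) (x : T) m :
  0 < m < order f x -> iter m f x != x.
Proof.
case/andP=> m_gt0 lt_m; apply/eqP => fm.
by have := findex_iter lt_m; rewrite fm findex0; lia.
Qed.

(** If j lies outside the orbit of i, composing s with the transposition of i and
    j alters s only at the preimages of i and j. The orbit of i meets these only
    at its very end, so it is followed unchanged until then, and its last step
    leads to j instead of i (iter_last_return). *)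
Lemma iter_first_return N (s : 'S_N) (i j : 'I_N) m :
  ~~ fconnect s i j -> m < order s i ->
  iter m (s * tperm i j)%g i = iter m s i.
Proof.
move=> s_ij; elim: m => [//|m IHm] lt_m /=.
rewrite IHm; last exact: ltnW.
rewrite permM tpermD // eq_sym; first by rewrite -iterS iter_neq_order.
by apply: contraNneq s_ij => <-; rewrite -iterS fconnect_iter.
Qed.

Lemma iter_last_return N (s : 'S_N) (i j : 'I_N) :
  ~~ fconnect s i j -> iter (order s i) (s * tperm i j)%g i = j.
Proof.
move=> s_ij; have := order_gt0 s i; case Ds: (order s i) => [//|l] _.
rewrite iterS iter_first_return ?Ds // permM -iterS -Ds.
by rewrite iter_order ?tpermL //; exact: perm_inj.
Qed.

(** Send a pair (s, j), where the orbit of i under s has size l and j is outside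
    it, to the permutation s * (i j). This is injective: j is recovered as the
    l-th iterate of i, and then s. There are N - l possible j for each s. *)
Lemma card_order_eq N (i : 'I_N) l :
  (N - l) * #|[set s : 'S_N | order s i == l]| <= N`!.
Proof.
pose A := [set x : 'S_N * 'I_N | (order x.1 i == l) && ~~ fconnect x.1 i x.2].
have -> : (N - l) * #|[set s : 'S_N | order s i == l]| = #|A|.
  transitivity (\sum_(s : 'S_N | order s i == l)
                  \sum_(j : 'I_N | ~~ fconnect s i j) 1); last first.
    by rewrite pair_big_dep -sum1_card; apply: eq_bigl => x; rewrite inE.
  rewrite mulnC -sum_nat_const; apply: eq_big => [s|s]; rewrite inE // => /eqP Ds.
  have total : l + #|[predC fconnect s i]| = N by rewrite -Ds cardC card_ord.
  suff -> : \sum_(j | ~~ fconnect s i j) 1 = #|[predC fconnect s i]| by lia.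
  by rewrite -sum1_card; apply: eq_bigl.
pose F (x : 'S_N * 'I_N) := (x.1 * tperm i x.2)%g.
rewrite -card_Sn -(card_in_imset (f := F)) ?max_card //.
case=> [s j] [t k]; rewrite !inE /F /= => /andP[/eqP Ds s_j] /andP[/eqP Dt t_k].
move=> eq_F; have Djk: j = k.
  by rewrite -(iter_last_return s_j) -(iter_last_return t_k) eq_F Ds Dt.
by rewrite Djk in eq_F *; rewrite (mulIg _ _ _ eq_F).
Qed.

(** The number of fixed points of s^c has mean at most 2c: a point fixed by s^c
    has an orbit of size l <= c, and each l has probability at most 1 / (N - c),
    which is at most 2 / N. *)
Lemma sum_card_periodic_points N c : 0 < c -> c.*2 <= N ->
  \sum_(s : 'S_N) #|periodic_points s c| <= c.*2 * N`!.
Proof.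
move=> c_gt0 le_cN.
have point (i : 'I_N) :
    (N - c) * #|[set s : 'S_N | i \in periodic_points s c]| <= c * N`!.
  have sub : [set s : 'S_N | i \in periodic_points s c] \subset
      \bigcup_(l < c) [set s : 'S_N | order s i == l.+1].
    apply/fintype.subsetP => s; rewrite !inE => /eqP sc.
    have le_oc : (order s i).-1 < c.
      rewrite prednK ?order_gt0 // leqNgt; apply/negP => lt_c.
      by have := @iter_neq_order _ s i c; rewrite c_gt0 lt_c sc eqxx => /(_ isT).
    apply/bigcupP; exists (Ordinal le_oc) => //.
    by rewrite inE /= prednK ?order_gt0.
  apply: leq_trans (leq_mul (leqnn _) (subset_leq_card sub)) _.
  have le_sum : #|\bigcup_(l < c) [set s : 'S_N | order s i == l.+1]| <=
      \sum_(l < c) #|[set s : 'S_N | order s i == l.+1]|.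
    elim/big_rec2: _ => [|l m A _ IH]; first by rewrite cards0.
    by apply: leq_trans (leq_card_setU _ _) _; rewrite leq_add2l.
  apply: leq_trans (leq_mul (leqnn _) le_sum) _.
  rewrite big_distrr /= -[c in c * _]card_ord -sum_nat_const.
  apply: leq_sum => l _; apply: leq_trans (card_order_eq i l.+1).
  by rewrite leq_mul2r leq_sub2l ?orbT.
have exch : \sum_(s : 'S_N) #|periodic_points s c| =
    \sum_(i < N) #|[set s : 'S_N | i \in periodic_points s c]|.
  under eq_bigr do rewrite -sum1_card big_mkcond /=.
  rewrite exchange_big; apply: eq_bigr => i _ /=.
  by rewrite -big_mkcond -sum1_card; apply: eq_bigl => s; rewrite inE.
have total : (N - c) * \sum_(s : 'S_N) #|periodic_points s c| <= N * (c * N`!).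
  rewrite exch big_distrr /= -[N in N * (_ * _)]card_ord -sum_nat_const.
  exact: leq_sum.
have N_gt0 : 0 < N by lia.
rewrite -(leq_pmul2l N_gt0).
have le_N : N <= (N - c).*2 by lia.
apply: leq_trans (leq_mul le_N (leqnn _)) _.
by rewrite -!mul2n -!mulnA [_ * (2 * _)]mulnCA leq_mul2l.
Qed.

End PeriodicPoints.

(** * Labelings, potentials and heights of a test graph *)
Section Labelings.
Local Open Scope nat_scope.
Implicit Type T : test_graph.

(** The end of e that has the larger number in a directed line: reversing the
    edges labeled x^* makes all edges point from lower to upper. *)
Definition upper T (e : edge T) := if star e then src e else tgt e.
Definition lower T (e : edge T) := if star e then tgt e else src e.

(** The values may lie in any type: besides the finite sets on which permutations
    act, the type of natural numbers with the successor map is used below. *)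
Definition labeling T (X : Type) (g : X -> X) (phi : vertex T -> X) : Prop :=
  forall e, phi (upper e) = g (phi (lower e)).

(** Walking from r to v gives a relation g^a (phi v) = g^b (phi r) with a and b
    independent of g and phi; M is a common upper bound of the a, which puts all
    these relations on the same power of g. *)
Lemma exists_potential T (r : vertex T) :
  exists (M : nat) (h : vertex T -> nat),
    forall (X : Type) (g : X -> X) (phi : vertex T -> X), labeling g phi ->
      forall v, iter M g (phi v) = iter (h v) g (phi r).
Proof.
(* p.1 counts the steps taken against g along the walk, p.2 those along g. *)
have walk (v : vertex T) : exists p : nat * nat,
    forall (X : Type) (g : X -> X) (phi : vertex T -> X), labeling g phi ->
    iter p.1 g (phi v) = iter p.2 g (phi r).
  have /connectP[p] := test_graph_connected r v.
  elim/last_ind: p v => [|p w IHp] v; first by move=> _ ->; exists (0, 0).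
  rewrite rcons_path last_rcons => /andP[/IHp/(_ erefl)[[a b] IH]] adj ->.
  case/existsP: adj => e /=.
  suff : lower e = last r p /\ upper e = w \/ lower e = w /\ upper e = last r p
      -> exists p0 : nat * nat, forall X (g : X -> X) (phi : vertex T -> X),
        labeling g phi -> iter p0.1 g (phi w) = iter p0.2 g (phi r).
    move=> W H; apply: W; rewrite /lower /upper.
    by case: (star e) => //; case/orP: H => /andP[/eqP-> /eqP->]; tauto.
  case=> [[lo up]|[lo up]].
    exists (a, b.+1) => X g phi lab /=; rewrite -up lab lo -iterSr iterS.
    by have /= -> := IH _ _ _ lab.
  exists (a.+1, b) => X g phi lab; rewrite [_.1]/= iterSr -lo -lab up.
  exact: (IH _ _ _ lab).
have [ab abP] := fin_all_exists walk.
exists (\max_v (ab v).1), (fun v => \max_v (ab v).1 - (ab v).1 + (ab v).2).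
move=> X g phi lab v; rewrite iterD -(abP v _ _ _ lab) -iterD subnK //.
exact: (leq_bigmax v).
Qed.

Lemma exists_vertex T : exists r : vertex T, true.
Proof. by have /card_gt0P[r _] := vertex_gt0 T; exists r. Qed.

(** This is what makes the trace of a connected graph at most N. *)
Lemma labeling_determined T (X : Type) (g : X -> X) (phi psi : vertex T -> X) r :
  injective g -> labeling g phi -> labeling g psi -> phi r = psi r ->
  phi =1 psi.
Proof.
move=> gI labf labp eq_r v; have [M [h hP]] := exists_potential r.
by apply: (iter_injective (n := M) gI); rewrite !hP // eq_r.
Qed.

Definition height T (k : vertex T -> nat) : Prop := labeling S k.

Lemma iter_S n m : iter n S m = n + m.
Proof. by rewrite iter_succn addnC. Qed.

(** The potential h of T is not a height, so it fails at some edge. Comparing the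
    value of a labeling at the upper end of that edge, computed from r directly
    or through the lower end, gives two different powers of g that agree at
    phi r. *)
Lemma nonheight_periodic T : ~ (exists k : vertex T -> nat, height k) ->
  exists2 c, 0 < c & exists r : vertex T,
    forall (X : Type) (g : X -> X) (phi : vertex T -> X), injective g ->
      labeling g phi -> iter c g (phi r) = phi r.
Proof.
move=> noheight; have [r _] := exists_vertex T.
have [M [h hP]] := exists_potential r.
have [e ne_e] : exists e : edge T, h (upper e) != (h (lower e)).+1.
  apply/existsP; rewrite -negb_forall; apply/forallP => H.
  by case: noheight; exists h => e; apply/eqP.
set a := h (upper e) in ne_e; set b := (h (lower e)).+1 in ne_e.
exists (a - b + (b - a)); first by move: ne_e; lia.
exists r => X g phi gI lab; apply: iter_dist => //.
by rewrite -hP // lab -iterSr iterS hP.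
Qed.

(** An injective height need not take consecutive values a priori, but its rank
    function is again an injective height, and it takes its values below the
    number of vertices. *)
Lemma directed_lineP T : directed_line T <->
  exists2 k : vertex T -> nat, height k & injective k.
Proof.
split=> [[K [f [K_gt0 f_bij fP]]]|[k kP kI]].
  exists (fun v => nat_of_ord (f v)); last first.
    by move=> v w /val_inj; apply: bij_inj.
  by move=> e; have := fP e; rewrite /upper /lower; case: (star e).
pose rank v := #|[set w | k w < k v]|.
have lt_rank v : rank v < #|vertex T|.
  rewrite -cardsT; apply/proper_card/properP; split; first exact: finset.subsetT.
  by exists v; rewrite !inE ?ltnn.
pose f v : 'I_#|vertex T| := Ordinal (lt_rank v).
exists #|vertex T|, f.
have mono v w : k v < k w -> rank v < rank w.
  move=> lt_vw; apply/proper_card/properP; split.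
    by apply/fintype.subsetP => u; rewrite !inE => /ltn_trans; apply.
  by exists v; rewrite !inE ?ltnn.
split; first exact: vertex_gt0.
  apply: inj_card_bij; last by rewrite card_ord.
  move=> v w /(congr1 val)/= eq_vw; apply: kI.
  by have [/mono|/mono|//] := ltngtP (k v) (k w); rewrite eq_vw ltnn.
move=> e.
suff step : rank (upper e) = (rank (lower e)).+1.
  by move: step; rewrite /upper /lower; case: (star e).
rewrite /rank kP; have -> : [set w | k w < (k (lower e)).+1] =
    lower e |: [set w | k w < k (lower e)].
  by apply/setP => w; rewrite !inE ltnS leq_eqVlt (inj_eq kI).
by rewrite cardsU1 inE ltnn.
Qed.

End Labelings.

(** * Counting labelings in a permutation *)
Section Counting.
Local Open Scope nat_scope.
Variables (T : test_graph) (N : nat).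
Implicit Types (g : 'S_N) (phi : {ffun vertex T -> 'I_N}).

Definition labelings g : {set {ffun vertex T -> 'I_N}} :=
  [set phi : {ffun _} | [forall e : edge T, phi (upper e) == g (phi (lower e))]].

Definition inj_labelings g := [set phi in labelings g | injectiveb phi].

Lemma labelingsP g phi : reflect (labeling g phi) (phi \in labelings g).
Proof.
by rewrite inE; apply: (iffP forallP) => H e; apply/eqP; have := H e => // ->.
Qed.

Lemma eval_labelings_inj g (r : vertex T) :
  {in labelings g &, injective (fun phi => phi r)}.
Proof.
move=> phi psi /labelingsP labf /labelingsP labp eq_r; apply/ffunP.
exact: labeling_determined perm_inj labf labp eq_r.
Qed.

Lemma card_labelings_le g : #|labelings g| <= N.
Proof.
have [r _] := exists_vertex T.
by rewrite -(card_in_imset (@eval_labelings_inj g r)) -[leqRHS]card_ord max_card.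
Qed.

Lemma card_inj_labelings_le g : #|inj_labelings g| <= #|labelings g|.
Proof. by apply/subset_leq_card/fintype.subsetP => phi; rewrite inE => /andP[]. Qed.

Definition orbit_map (k : vertex T -> nat) g (i : 'I_N) : {ffun vertex T -> 'I_N} :=
  [ffun v => iter (k v) g i].

Lemma orbit_map_labeling (k : vertex T -> nat) g i :
  height k -> orbit_map k g i \in labelings g.
Proof. by move=> kP; apply/labelingsP => e; rewrite !ffunE kP. Qed.

Lemma orbit_map_inj k g : injective (orbit_map k g).
Proof.
move=> i j /ffunP eq_ij; have [r _] := exists_vertex T.
have := eq_ij r; rewrite !ffunE; apply: iter_injective; exact: perm_inj.
Qed.

Lemma card_labelings_height (k : vertex T -> nat) g : height k -> #|labelings g| = N.
Proof.
move=> kP; apply/eqP; rewrite eqn_leq card_labelings_le /=.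
rewrite -[leqLHS]card_ord -cardsT -(card_imset _ (@orbit_map_inj k g)).
apply/subset_leq_card/fintype.subsetP => _ /finset.imsetP[i _ ->].
exact: orbit_map_labeling.
Qed.

(** The labeling started at i takes the same value at v and w only if i is fixed
    by the power k v - k w of g. *)
Lemma card_inj_labelings_line (k : vertex T -> nat) g : height k -> injective k ->
  N <= #|inj_labelings g| +
    \sum_(p : vertex T * vertex T | p.1 != p.2)
      #|periodic_points g (k p.1 - k p.2 + (k p.2 - k p.1))|.
Proof.
move=> kP kI.
pose good := [set i | injectiveb (orbit_map k g i)].
pose bad := \bigcup_(p : vertex T * vertex T | p.1 != p.2)
  [set i in periodic_points g (k p.1 - k p.2 + (k p.2 - k p.1))].
have cover : [set: 'I_N] \subset good :|: bad.
  apply/fintype.subsetP => i _; rewrite finset.in_setU inE.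
  case: (boolP (injectiveb _)) => //= /injectivePn[v [w ne_vw]].
  rewrite !ffunE => eq_vw; apply/bigcupP; exists (v, w) => //.
  by rewrite !inE; apply/eqP/iter_dist => //; exact: perm_inj.
rewrite -[leqLHS]card_ord -cardsT.
apply: leq_trans (subset_leq_card cover) _.
apply: leq_trans (leq_card_setU _ _) _.
apply: leq_add.
  rewrite -(card_imset _ (@orbit_map_inj k g)).
  apply/subset_leq_card/fintype.subsetP => _ /finset.imsetP[i iI ->].
  by rewrite inE in iI; rewrite finset.in_set orbit_map_labeling // iI.
rewrite /bad; elim/big_rec2: _ => [|p m A _ IH]; first by rewrite cards0.
apply: leq_trans (leq_card_setU _ _) _; rewrite leq_add //.
by rewrite cardsE.
Qed.

End Counting.

(** The constant c does not depend on N, which allows the number of labelings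
    to be averaged over permutations and compared with N. *)
Lemma card_labelings_nonheight T :
  ~ (exists k : vertex T -> nat, height k) ->
  exists2 c, (0 < c)%N &
    forall N (g : 'S_N), (#|labelings T g| <= #|periodic_points g c|)%N.
Proof.
move=> /nonheight_periodic[c c_gt0 [r rP]]; exists c => // N g.
rewrite -(card_in_imset (@eval_labelings_inj T N g r)).
apply/subset_leq_card/fintype.subsetP => _ /finset.imsetP[phi /labelingsP lab ->].
by rewrite inE rP //; exact: perm_inj.
Qed.

Lemma card_inj_labelings_nonline T : ~ directed_line T ->
  exists2 c, (0 < c)%N &
    forall N (g : 'S_N), (#|inj_labelings T g| <= #|periodic_points g c|)%N.
Proof.
move=> nonline.
have [[k kP]|/card_labelings_nonheight[c c_gt0 cP]] :=
  pselect (exists k : vertex T -> nat, height k); last first.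
  by exists c => // N g; apply: leq_trans (card_inj_labelings_le _ g) (cP N g).
(* With a height that is not injective there is no injective labeling at all. *)
exists 1%N => // N g.
have [v [w [ne_vw eq_vw]]] : exists v w, v != w /\ k v = k w.
  apply/not_existsP => H; apply/nonline/directed_lineP; exists k => // v w eq_vw.
  by apply/eqP/negPn/negP => ne_vw; apply: (H v); exists w.
rewrite (_ : inj_labelings T g = finset.set0) ?cards0 //.
apply/setP => phi; rewrite finset.in_set finset.in_set0.
apply/negP => /andP[lab /injectiveP phiI].
have {}lab : labeling g phi by apply/labelingsP.
have [r _] := exists_vertex T; have [M [h hP]] := exists_potential r.
(* The height k is itself a labeling, for the successor map; so the potential h
   differs from it by a constant. *)
have eq_h : h v = h w.
  have := hP _ _ _ kP v; have := hP _ _ _ kP w; rewrite !iter_S eq_vw; lia.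
case/eqP: ne_vw; apply/phiI/(iter_injective (n := M) (@perm_inj _ g)).
by rewrite !hP // eq_h.
Qed.


Local Open Scope classical_set_scope.
Local Open Scope complex_scope.
Local Open Scope ring_scope.

(** * Traces of permutation matrices *)
Section PermutationTraces.
Variables (R : realType) (T : test_graph) (N : nat).

Lemma graph_weight_perm (s : 'S_N) (phi : {ffun vertex T -> 'I_N}) :
  graph_weight (perm_mx s : 'M[R[i]]_N) phi = (phi \in labelings T s^-1)%:R.
Proof.
have edgeE (e : edge T) :
    (if star e then map_mx Num.conj (perm_mx s)^T else perm_mx s)
      (phi (tgt e)) (phi (src e)) = (phi (upper e) == s^-1%g (phi (lower e)))%:R
    :> R[i].
  rewrite -[_ == s^-1%g _](inj_eq (@perm_inj _ s)) permKV /upper /lower.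
  by case: (star e); rewrite !mxE ?conjC_nat.
rewrite /graph_weight (eq_bigr _ (fun e _ => edgeE e)) inE.
case: forallP => [H|H]; first by rewrite big1 // => e _; rewrite H.
have /forallPn[e /negPf e0] :
    ~~ [forall e : edge T, phi (upper e) == s^-1%g (phi (lower e))].
  by apply/forallP.
by rewrite (bigD1 e) //= e0 mul0r.
Qed.

Lemma Tr_perm (s : 'S_N) : Tr T (perm_mx s : 'M[R[i]]_N) = #|labelings T s^-1|%:R.
Proof.
rewrite /Tr (eq_bigr _ (fun phi _ => graph_weight_perm s phi)).
by rewrite -natr_sum -big_mkcond sum1_card.
Qed.

Lemma Tr0_perm (s : 'S_N) :
  Tr0 T (perm_mx s : 'M[R[i]]_N) = #|inj_labelings T s^-1|%:R.
Proof.
rewrite /Tr0 (eq_bigr _ (fun phi _ => graph_weight_perm s phi)).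
rewrite -natr_sum -big_mkcondr sum1_card; congr (_%:R); apply: eq_card => phi.
by rewrite [in RHS]finset.in_set andbC.
Qed.

End PermutationTraces.

(** * Measurability of complex random variables *)
Section ComplexMeasurability.
Variables (R : realType) (d : measure_display) (Om : measurableType d).
Implicit Types X Y : Om -> R[i].

Definition cmeasurable X : Prop :=
  measurable_fun [set: Om] (fun w => complex.Re (X w)) /\
  measurable_fun [set: Om] (fun w => complex.Im (X w)).

Lemma cmeasurable_cst (z : R[i]) : cmeasurable (fun=> z).
Proof. by split; apply: measurable_cst. Qed.

Lemma cmeasurableD X Y :
  cmeasurable X -> cmeasurable Y -> cmeasurable (fun w => X w + Y w).
Proof.
move=> [Xr Xi] [Yr Yi]; split.
  rewrite (_ : (fun _ => _) = (fun w => complex.Re (X w) + complex.Re (Y w))).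
    exact: measurable_funD.
  by apply/funext => w; case: (X w) (Y w) => [a b] [a' b'].
rewrite (_ : (fun _ => _) = (fun w => complex.Im (X w) + complex.Im (Y w))).
  exact: measurable_funD.
by apply/funext => w; case: (X w) (Y w) => [a b] [a' b'].
Qed.

Lemma cmeasurableM X Y :
  cmeasurable X -> cmeasurable Y -> cmeasurable (fun w => X w * Y w).
Proof.
move=> [Xr Xi] [Yr Yi]; split.
  rewrite (_ : (fun _ => _) = (fun w => complex.Re (X w) * complex.Re (Y w)
                                 - complex.Im (X w) * complex.Im (Y w))).
    by apply: measurable_funB; apply: measurable_funM.
  by apply/funext => w; case: (X w) (Y w) => [a b] [a' b'].
rewrite (_ : (fun _ => _) = (fun w => complex.Re (X w) * complex.Im (Y w)
                               + complex.Im (X w) * complex.Re (Y w))).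
  by apply: measurable_funD; apply: measurable_funM.
by apply/funext => w; case: (X w) (Y w) => [a b] [a' b'].
Qed.

Lemma cmeasurable_conj X : cmeasurable X -> cmeasurable (fun w => (X w)^*)%R.
Proof.
move=> [Xr Xi]; split.
  by rewrite (_ : (fun _ => _) = (fun w => complex.Re (X w))) //;
    apply/funext => w; case: (X w).
rewrite (_ : (fun _ => _) = (fun w => - complex.Im (X w))).
  exact: measurable_funN.
by apply/funext => w; case: (X w).
Qed.

Lemma cmeasurable_sum (I : Type) (r : seq I) (P : pred I) (F : I -> Om -> R[i]) :
  (forall i, cmeasurable (F i)) -> cmeasurable (fun w => \sum_(i <- r | P i) F i w).
Proof.
move=> mF; elim: r => [|i r IHr].
  by under eq_fun do rewrite big_nil; apply: cmeasurable_cst.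
under eq_fun do rewrite big_cons.
by case: (P i) => //; apply: cmeasurableD.
Qed.

Lemma cmeasurable_prod (I : Type) (r : seq I) (P : pred I) (F : I -> Om -> R[i]) :
  (forall i, cmeasurable (F i)) -> cmeasurable (fun w => \prod_(i <- r | P i) F i w).
Proof.
move=> mF; elim: r => [|i r IHr].
  by under eq_fun do rewrite big_nil; apply: cmeasurable_cst.
under eq_fun do rewrite big_cons.
by case: (P i) => //; apply: cmeasurableM.
Qed.

Variables (N : nat) (A : Om -> 'M[R[i]]_N).
Hypothesis mA : random_matrix A.

Lemma cmeasurable_graph_weight (T : test_graph) (phi : vertex T -> 'I_N) :
  cmeasurable (fun w => graph_weight (A w) phi).
Proof.
apply: cmeasurable_prod => e; case: (star e); last exact: mA.
by under eq_fun do rewrite !mxE; apply/cmeasurable_conj/mA.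
Qed.

Lemma cmeasurable_Tr (T : test_graph) :
  cmeasurable (fun w => N%:R^-1 * Tr T (A w)).
Proof.
apply: cmeasurableM; first exact: cmeasurable_cst.
by apply: cmeasurable_sum => phi; apply: cmeasurable_graph_weight.
Qed.

Lemma cmeasurable_Tr0 (T : test_graph) :
  cmeasurable (fun w => N%:R^-1 * Tr0 T (A w)).
Proof.
apply: cmeasurableM; first exact: cmeasurable_cst.
by apply: cmeasurable_sum => phi; apply: cmeasurable_graph_weight.
Qed.

End ComplexMeasurability.

(** * Expectation under the uniform law on permutations *)
Section UniformExpectation.
Variables (R : realType) (d : measure_display) (Om : measurableType d).
Variables (P : probability Om R) (N : nat) (A : Om -> 'M[R[i]]_N).
Hypothesis hA : uniform_permutation_matrix P A.

Definition avg (x : 'S_N -> R) : R := (N`!%:R)^-1 * \sum_s x s.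

Definition perm_event (s : 'S_N) : set Om := [set w | A w = perm_mx s].

(** Only the entries of A are assumed measurable, so the event is written as a
    finite intersection of conditions on their real and imaginary parts. *)
Lemma measurable_perm_event s : measurable (perm_event s).
Proof.
have -> : perm_event s = \bigcap_(i in [set: 'I_N]) \bigcap_(j in [set: 'I_N])
    ((fun w => complex.Re (A w i j)) @^-1` [set complex.Re (perm_mx s i j : R[i])] `&`
     (fun w => complex.Im (A w i j)) @^-1` [set complex.Im (perm_mx s i j : R[i])]).
  apply/seteqP; split=> w /=; first by move=> Aw i _ j _ /=; rewrite Aw.
  move=> Aw; apply/matrixP => i j; have [/= re im] := Aw i I j I.
  by apply/eqP; rewrite eq_complex re im !eqxx.
have [mA _] := hA.
apply: fin_bigcap_measurable => // i _; apply: fin_bigcap_measurable => // j _.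
have [mre mim] := mA i j.
apply: measurableI.
  by rewrite -[X in measurable X]setTI; apply: mre.
by rewrite -[X in measurable X]setTI; apply: mim.
Qed.

Lemma perm_event_disjoint s t w : perm_event s w -> perm_event t w -> s = t.
Proof.
move=> As At; apply/permP => i.
have := congr1 (fun M : 'M[R[i]]_N => M i (s i)) (etrans (esym As) At).
rewrite !mxE eqxx.
by case: eqP => // _ /eqP; rewrite oner_eq0.
Qed.

(** The permutation events are disjoint and have total probability N! / N! = 1, so
    A is almost surely a permutation matrix, and the values of Y elsewhere are
    irrelevant: Y is integrated on each event and on a null set. *)
Lemma expectation_uniform (Y : Om -> R) (y : 'S_N -> R) :
  measurable_fun [set: Om] Y -> (forall s w, perm_event s w -> Y w = y s) ->
  ('E_P[Y] = (avg y)%:E)%E.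
Proof.
move=> mY Yy.
pose D := \big[setU/set0]_(s <- enum 'S_N) perm_event s.
have mE := measurable_perm_event.
have mD : measurable D by apply: bigsetU_measurable => s _; exact: mE.
have disj : trivIset [set` enum 'S_N] perm_event.
  by move=> s t _ _ [w [/perm_event_disjoint H /H]].
have sum_D (Z : Om -> R) (z : 'S_N -> R) : measurable_fun D Z ->
    (forall s w, perm_event s w -> Z w = z s) ->
    (\int[P]_(w in D) (Z w)%:E = (avg z)%:E)%E.
  move=> mZ Zz; rewrite integral_bigsetU_EFin ?enum_uniq //; last first.
    exact/measurable_EFinP.
  rewrite big_enum /= /avg mulr_sumr -sumEFin; apply: eq_bigr => s _.
  rewrite (eq_integral (cst (z s)%:E)); last first.
    by move=> w; rewrite inE => /Zz ->.
  rewrite integral_cst // EFinM muleC; congr (_ * _)%E.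
  by case: hA => _ /(_ s).
have PD : P D = 1%E.
  rewrite -[LHS]mul1e -integral_cst // (sum_D (cst 1) (cst 1)) //.
  by rewrite /avg sumr_const card_Sn mulVf // pnatr_eq0 -lt0n fact_gt0.
have PDc : P (~` D) = 0%E by rewrite probability_setC // PD subee.
rewrite unlock -[setT](setUv D) integral_setU; [|by []|exact: measurableC| |].
- rewrite (sum_D Y y) ?null_set_integral ?adde0 //; [exact: measurableC| |].
  + exact/measurable_EFinP/measurable_funTS.
  + exact: measurable_funTS.
- by rewrite setUv; apply/measurable_EFinP.
- by rewrite disj_set2E setICr.
Qed.

Lemma avg_cst (a : R) : avg (fun=> a) = a.
Proof.
by rewrite /avg sumr_const card_Sn -[a *+ _]mulr_natl mulKf.
Qed.

Lemma cexpectation_uniform (X : Om -> R[i]) (x : 'S_N -> R) :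
  cmeasurable X -> (forall s w, perm_event s w -> X w = (x s)%:C) ->
  cexpectation P X = (avg x)%:C.
Proof.
move=> [mRe mIm] Xx; rewrite /cexpectation.
rewrite (expectation_uniform (y := x)) //; last by move=> s w /Xx ->.
rewrite (expectation_uniform (y := cst 0)) //; last by move=> s w /Xx ->.
by rewrite (avg_cst 0).
Qed.

Lemma avg_le (x y : 'S_N -> R) : (forall s, x s <= y s) -> avg x <= avg y.
Proof.
by move=> le_xy; rewrite ler_wpM2l ?invr_ge0 ?ler0n //; apply: ler_sum.
Qed.

Lemma avg_inv (x : 'S_N -> R) : avg (fun s => x s^-1%g) = avg x.
Proof.
have invI : injective (fun s : 'S_N => s^-1%g) by exact: invg_inj.
by rewrite /avg [in RHS](reindex_inj invI).
Qed.

Lemma avg_sum (I : finType) (Q : pred I) (x : I -> 'S_N -> R) :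
  avg (fun s => \sum_(i | Q i) x i s) = \sum_(i | Q i) avg (x i).
Proof. by rewrite /avg exchange_big mulr_sumr. Qed.

Lemma avgB (x y : 'S_N -> R) : avg (fun s => x s - y s) = avg x - avg y.
Proof. by rewrite /avg sumrB mulrBr. Qed.

End UniformExpectation.

(** * Limits of averages over permutations *)
Section Limits.
Variable R : realType.

(** The limits are computed in R and transferred to the complex numbers. *)
Lemma cvg_real_complex (u : nat -> R) (l : R) : u n @[n --> \oo] --> l ->
  ((u n)%:C : R[i]^o) @[n --> \oo] --> (l%:C : R[i]^o).
Proof.
move=> ul; apply/cvgrPdist_le => e e_gt0.
have e_real : e = (complex.Re e)%:C by rewrite RRe_real // gtr0_real.
have : 0 < complex.Re e by rewrite -ltcR -e_real.
move/(cvgrPdist_le _ _).1 : ul => /[apply].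
apply: filterS => n le_n.
rewrite e_real -rmorphB normc_def /= expr0n addr0 sqrtr_sqr lecR.
exact: le_n.
Qed.

Lemma cvg_avg_periodic c : (0 < c)%N ->
  avg (fun s : 'S_N => #|periodic_points s c|%:R / N%:R : R) @[N --> \oo] --> (0 : R).
Proof.
move=> c_gt0.
have bound : (c.*2%:R * N%:R^-1 : R) @[N --> \oo] --> (0 : R).
  rewrite -[X in _ --> X](mulr0 (c.*2%:R)).
  apply: cvgM; first exact: cvg_cst.
  apply/gtr0_cvgV0; last exact: cvgr_idn.
  by near=> N; rewrite ltr0n; near: N; exact: nbhs_infty_gt.
apply: (squeeze_cvgr _ (cvg_cst 0) bound).
near=> N; apply/andP; split.
  by rewrite -(avg_cst N (0 : R)); apply: avg_le => s; rewrite divr_ge0.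
have le_cN : (c.*2 <= N)%N by near: N; exact: nbhs_infty_ge.
rewrite /avg -mulr_suml mulrA ler_wpM2r ?invr_ge0 //.
rewrite -natr_sum mulrC ler_pdivrMr ?ltr0n ?fact_gt0 // -natrM ler_nat.
exact: sum_card_periodic_points.
Unshelve. all: by end_near.
Qed.

(** The bound involves the inverse of s because labelings follow the inverse of
    the permutation; averaging over s or over its inverse is the same. *)
Lemma cvg_avg_dominated c (x : forall N, 'S_N -> R) : (0 < c)%N ->
  (forall N s, 0 <= x N s <= #|periodic_points s^-1%g c|%:R / N%:R) ->
  avg (@x N) @[N --> \oo] --> (0 : R).
Proof.
move=> c_gt0 le_x; apply: (squeeze_cvgr _ (cvg_cst 0) (cvg_avg_periodic c_gt0)).
apply: nearW => N; apply/andP; split.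
  by rewrite -(avg_cst N (0 : R)); apply: avg_le => s; case/andP: (le_x N s).
rewrite -(avg_inv (fun s : 'S_N => #|periodic_points s c|%:R / N%:R)).
by apply: avg_le => s; case/andP: (le_x N s).
Qed.

End Limits.

(** * Limits of the normalized traces *)
Section PermutationLimits.
Variables (R : realType) (d : nat -> measure_display).
Variable (Om : forall N : nat, measurableType (d N)).
Variable (P : forall N : nat, probability (Om N) R).
Variable (V : forall N : nat, Om N -> 'M[R[i]]_N).
Hypothesis hV : forall N : nat, uniform_permutation_matrix (P N) (@V N).

Definition density (T : test_graph) N (s : 'S_N) : R :=
  #|labelings T s^-1|%:R / N%:R.

Definition inj_density (T : test_graph) N (s : 'S_N) : R :=
  #|inj_labelings T s^-1|%:R / N%:R.

Lemma density_ge0 T N (s : 'S_N) : 0 <= density T s.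
Proof. by rewrite divr_ge0. Qed.

Lemma density_le1 T N (s : 'S_N) : density T s <= 1.
Proof.
case: N s => [|N] s; first by rewrite /density invr0 mulr0.
by rewrite ler_pdivrMr ?ltr0n // mul1r ler_nat card_labelings_le.
Qed.

Lemma normalized_Tr T N (s : 'S_N) (w : Om N) : perm_event (@V N) s w ->
  N%:R^-1 * Tr T (V w) = (density T s)%:C.
Proof.
by move=> ->; rewrite Tr_perm mulrC rmorphM fmorphV !rmorph_nat.
Qed.

Lemma normalized_Tr0 T N (s : 'S_N) (w : Om N) : perm_event (@V N) s w ->
  N%:R^-1 * Tr0 T (V w) = (inj_density T s)%:C.
Proof.
by move=> ->; rewrite Tr0_perm mulrC rmorphM fmorphV !rmorph_nat.
Qed.

Lemma tau_mxE T N : tau_mx (P N) T (@V N) = (avg (density T (N := N)))%:C.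
Proof.
have [mV _] := hV N; apply: (cexpectation_uniform (hV N)).
  exact: cmeasurable_Tr.
by move=> s w; apply: normalized_Tr.
Qed.

Lemma tau0_mxE T N : tau0_mx (P N) T (@V N) = (avg (inj_density T (N := N)))%:C.
Proof.
have [mV _] := hV N; apply: (cexpectation_uniform (hV N)).
  exact: cmeasurable_Tr0.
by move=> s w; apply: normalized_Tr0.
Qed.

Lemma density_height T (k : vertex T -> nat) N (s : 'S_N) :
  height k -> (0 < N)%N -> density T s = 1.
Proof.
move=> kP N_gt0; rewrite /density (card_labelings_height _ kP).
by rewrite divff // pnatr_eq0 -lt0n.
Qed.

Lemma cvg_tau_height T : (exists k : vertex T -> nat, height k) ->
  tau_mx (P N) T (@V N) @[N --> \oo] --> (1 : R[i]^o).
Proof.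
move=> [k kP]; under eq_fun do rewrite tau_mxE.
apply: (cvg_real_complex (l := 1)); apply: cvg_near_cst.
near=> N; have N_gt0 : (0 < N)%N by near: N; exact: nbhs_infty_gt.
rewrite -[RHS](avg_cst N); congr avg; apply/funext => s.
exact: density_height kP _.
Unshelve. all: by end_near.
Qed.

Lemma nonheight_density T : ~ (exists k : vertex T -> nat, height k) ->
  exists2 c, (0 < c)%N & forall N (s : 'S_N),
    density T s <= #|periodic_points s^-1%g c|%:R / N%:R.
Proof.
move=> /card_labelings_nonheight[c c_gt0 cP]; exists c => // N s.
by rewrite ler_wpM2r ?invr_ge0 // ler_nat.
Qed.

Lemma cvg_tau_nonheight T : ~ (exists k : vertex T -> nat, height k) ->
  tau_mx (P N) T (@V N) @[N --> \oo] --> (0 : R[i]^o).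
Proof.
move=> /nonheight_density[c c_gt0 cP]; under eq_fun do rewrite tau_mxE.
apply: (cvg_real_complex (l := 0)); apply: (cvg_avg_dominated c_gt0) => N s.
by rewrite density_ge0 cP.
Qed.

Lemma converges_permutation : converges_in_traffic_distribution P V.
Proof.
move=> T; have [/cvg_tau_height H|/cvg_tau_nonheight H] :=
  pselect (exists k : vertex T -> nat, height k); apply/cvg_ex; eexists; exact: H.
Qed.

Lemma traffic_limitE T (l : R[i]^o) :
  tau_mx (P N) T (@V N) @[N --> \oo] --> l -> traffic_limit P V T = l.
Proof. by move=> H; apply: cvg_lim. Qed.

Lemma cexpectation_prod K (Ts : 'I_K -> test_graph) N :
  cexpectation (P N) (fun w => \prod_(k < K) (N%:R^-1 * Tr (Ts k) (V w)))
  = (avg (fun s : 'S_N => \prod_(k < K) density (Ts k) s))%:C.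
Proof.
have [mV _] := hV N; apply: (cexpectation_uniform (hV N)).
  by apply: cmeasurable_prod => k; exact: cmeasurable_Tr.
move=> s w sw; rewrite rmorph_prod; apply: eq_bigr => k _.
exact: normalized_Tr.
Qed.

(** Each factor lies in [0, 1]. If all graphs have a height the product is 1;
    otherwise it is at most a factor that tends to 0 in mean. *)
Lemma factorization_permutation : factorization_property P V.
Proof.
split; first exact: converges_permutation.
move=> K Ts _; under eq_fun do rewrite cexpectation_prod.
have [allP|] := pselect (forall k, exists h : vertex (Ts k) -> nat, height h).
  rewrite big1 => [|k _]; last exact/traffic_limitE/cvg_tau_height.
  apply: (cvg_real_complex (l := 1)); apply: cvg_near_cst.
  near=> N; have N_gt0 : (0 < N)%N by near: N; exact: nbhs_infty_gt.
  rewrite -[RHS](avg_cst N); congr avg; apply/funext => s.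
  by rewrite big1 // => k _; have [h hP] := allP k; apply: density_height hP _.
move=> /existsNP[k0 nk0].
rewrite (bigD1 k0) //= (traffic_limitE (cvg_tau_nonheight nk0)) mul0r.
have [c c_gt0 cP] := nonheight_density nk0.
apply: (cvg_real_complex (l := 0)); apply: (cvg_avg_dominated c_gt0) => N s.
rewrite prodr_ge0 => [|k _]; last exact: density_ge0.
apply: le_trans (cP N s); rewrite (bigD1 k0) //= ler_piMr ?density_ge0 //.
by apply: prodr_ile1 => k _; rewrite density_ge0 density_le1.
Unshelve. all: by end_near.
Qed.

Lemma cvg_tau0_line T : directed_line T ->
  tau0_mx (P N) T (@V N) @[N --> \oo] --> (1 : R[i]^o).
Proof.
move=> /directed_lineP[k kP kI]; under eq_fun do rewrite tau0_mxE.
apply: (cvg_real_complex (l := 1)).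
(* err N bounds the expected proportion of the points whose labeling takes the
   same value at two distinct vertices. *)
pose c (p : vertex T * vertex T) := (k p.1 - k p.2 + (k p.2 - k p.1))%N.
pose err N := \sum_(p : vertex T * vertex T | p.1 != p.2)
  avg (fun s : 'S_N => #|periodic_points s (c p)|%:R / N%:R : R).
have err0 : (1 - err N) @[N --> \oo] --> (1 : R).
  rewrite -[X in _ --> X]subr0; apply: cvgB; first exact: cvg_cst.
  have <- : \sum_(p : vertex T * vertex T | p.1 != p.2) (0 : R) = 0.
    by rewrite big1.
  apply: cvg_big => [|p ne_p]; first exact: add_continuous.
  apply: cvg_avg_periodic.
  rewrite /c; have /eqP : k p.1 != k p.2 by rewrite (inj_eq kI).
  lia.
apply: (squeeze_cvgr _ err0 (cvg_cst (1 : R))).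
near=> N; have N_gt0 : (0 < N)%N by near: N; exact: nbhs_infty_gt.
apply/andP; split; last first.
  rewrite -(avg_cst N (1 : R)); apply: avg_le => s.
  apply: le_trans (density_le1 T s).
  by rewrite ler_wpM2r ?invr_ge0 // ler_nat card_inj_labelings_le.
rewrite -(avg_cst N (1 : R)) /err -avg_sum -(avg_inv (fun s => \sum_(p | _) _)) -avgB.
apply: avg_le => s; rewrite lerBlDr -mulr_suml -mulrDl ler_pdivlMr ?ltr0n //.
by rewrite mul1r -natr_sum -natrD ler_nat card_inj_labelings_line.
Unshelve. all: by end_near.
Qed.

Lemma cvg_tau0_nonline T : ~ directed_line T ->
  tau0_mx (P N) T (@V N) @[N --> \oo] --> (0 : R[i]^o).
Proof.
move=> /card_inj_labelings_nonline[c c_gt0 cP]; under eq_fun do rewrite tau0_mxE.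
apply: (cvg_real_complex (l := 0)); apply: (cvg_avg_dominated c_gt0) => N s.
by rewrite divr_ge0 //= ler_wpM2r ?invr_ge0 // ler_nat.
Qed.

End PermutationLimits.

Unset Implicit Arguments.
Set Strict Implicit.
Set Printing Implicit Defensive.

Theorem proposition3p6 (R : realType) (d : nat -> measure_display)
  (Om : forall N : nat, measurableType (d N))
  (P : forall N : nat, probability (Om N) R)
  (V : forall N : nat, Om N -> 'M[R[i]]_N)
  (hV : forall N : nat, uniform_permutation_matrix (P N) (V N)) :
  [/\ converges_in_traffic_distribution P V,
      factorization_property P V &
      forall T : test_graph,
        (directed_line T -> tau0_mx (P N) T (V N) @[N --> \oo] --> (1 : R[i]^o)) /\
        (~ directed_line T -> tau0_mx (P N) T (V N) @[N --> \oo] --> (0 : R[i]^o))].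
Proof.
split; [exact: converges_permutation|exact: factorization_permutation|].
by move=> T; split; [exact: cvg_tau0_line|exact: cvg_tau0_nonline].
Qed.
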